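(* Let $G$ be a graph of order $n$, let $r=|S(G)|$, and let $t$ ($1\le t\le r$) be the minimum number such that every $t$-element subset $F\subseteq S(G)$ satisfies $N_{D(G)}(F)=V_s(G)$. Then $\mathrm{fxd}(G)=t+|V(G)\setminus S(G)|$.
   Context: Graphs are finite, simple, connected, with nontrivial automorphism group $\mathrm{Aut}(G)$ (standing assumption). For $S\subseteq V(G)$, $\mathrm{stab}(S)=\{g\in \mathrm{Aut}(G): g(v)=v \text{ for all } v\in S\}$; $S$ is a fixing set if $\mathrm{stab}(S)$ is trivial. $\mathrm{fxd}(G)$ is the minimum $k$ such that every $k$-element subset of $V(G)$ is a fixing set. Vertices $u,v$ are similar if $g(u)=v$ for some $g\in\mathrm{Aut}(G)$. $S(G)$ is the set of vertices similar to some vertex other than themselves; $V_s(G)$ is the set of pairs $(u,v)$ of distinct similar vertices of $G$ (regarded as unordered). For $F\subseteq S(G)$, $N_{D(G)}(F)=\{(x,y)\in V_s(G): \text{there is no } g\in\mathrm{stab}(F) \text{ with } g(x)=y\}$. *)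

(* Defs.v *)
From mathcomp Require Import all_boot all_fingroup.

Set Implicit Arguments.
Unset Strict Implicit.
Unset Printing Implicit Defensive.

Local Open Scope group_scope.

Record sgraph := SGraph {
  vertex :> finType;
  adj : rel vertex;
  adj_sym : symmetric adj;
  adj_irr : irreflexive adj }.

Definition connected_graph (G : sgraph) : Prop :=
  0 < #|G| /\ forall x y : G, connect (@adj G) x y.

Definition graph_aut (G : sgraph) : {set {perm G}} :=
  [set g : {perm G} | [forall x, forall y, adj (g x) (g y) == adj x y]].

Lemma graph_aut_group_set (G : sgraph) : group_set (graph_aut G).
Proof.
apply/group_setP; split=> [|g h].
  by rewrite inE; apply/'forall_'forall_eqP=> x y; rewrite !perm1.
rewrite !inE => /'forall_'forall_eqP aut_g /'forall_'forall_eqP aut_h.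
by apply/'forall_'forall_eqP=> x y; rewrite !permM aut_h aut_g.
Qed.

Canonical graph_aut_group (G : sgraph) : {group {perm G}} :=
  Group (graph_aut_group_set G).

Definition stab (G : sgraph) (F : {set G}) : {set {perm G}} :=
  [set g in graph_aut G | [forall v in F, g v == v]].

Definition fixing (G : sgraph) (F : {set G}) : bool := stab F == 1.

Definition all_fixing (G : sgraph) (k : nat) : bool :=
  [forall F : {set G}, (#|F| == k) ==> fixing F].

Lemma exists_all_fixing (G : sgraph) : exists k, all_fixing G k.
Proof.
exists #|G|; apply/forall_inP=> F; rewrite -cardsT => cardF.
have -> : F = [set: G] by apply/eqP; rewrite eqEcard subsetT (eqP cardF) /=.
apply/eqP/setP=> g; rewrite inE in_set1.
apply/andP/eqP=> [[_ /forall_inP fix_g]|->].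
  by apply/permP=> x; rewrite perm1; apply/eqP/fix_g; rewrite inE.
by split; [exact: (group1 (graph_aut_group G)) |
           apply/forall_inP=> x _; rewrite perm1].
Qed.

Definition fxd (G : sgraph) : nat := ex_minn (exists_all_fixing G).

Definition similar (G : sgraph) (u v : G) : bool :=
  [exists g in graph_aut G, g u == v].

Definition similar_vertices (G : sgraph) : {set G} :=
  [set v | [exists u, (u != v) && similar v u]].

(* The unordered pair of x and y is the two-element set [set x; y]. *)
Definition similar_pairs (G : sgraph) : {set {set G}} :=
  [set [set x; y] | x in G, y in G & (x != y) && similar x y].

(* The conditions on (x, y) here and in similar_pairs are symmetric in x and y,
   as graph_aut G and stab F are groups; so an unordered pair belongs to these
   sets exactly when either ordering of it satisfies the condition. *)
Definition separated_pairs (G : sgraph) (F : {set G}) : {set {set G}} :=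
  [set [set x; y] | x in G, y in G &
     [&& x != y, similar x y & ~~ [exists g in stab F, g x == y]]].

Definition all_separating (G : sgraph) (t : nat) : Prop :=
  forall F : {set G}, F \subset similar_vertices G -> #|F| = t ->
    separated_pairs F = similar_pairs G.

(* Main.v *)
Require Import Defs.
From mathcomp Require Import all_boot all_fingroup.

(** Every automorphism fixes the vertices outside S(G), so stab F depends only
    on the intersection of F with S(G), and F separates all similar pairs
    exactly when stab F is trivial. A set of t + |V \ S(G)| vertices therefore
    meets S(G) in at least t vertices and is fixing; conversely, the smallest
    traces on S(G) of k-sets come from sets containing V \ S(G), so if every
    k-set is fixing then so is every subset of S(G) of size k - |V \ S(G)|. *)

Lemma stabP (G : sgraph) (F : {set G}) (g : {perm G}) :
  reflect (g \in graph_aut G /\ {in F, forall v, g v = v}) (g \in stab F).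
Proof.
rewrite [g \in stab F]in_set; apply: (iffP andP) => [[gG /forall_inP gF]|[gG gF]]; split=> //.
  by move=> v /gF/eqP.
by apply/forall_inP=> v /gF/eqP.
Qed.

Lemma stab1 (G : sgraph) (F : {set G}) : 1%g \in stab F.
Proof.
apply/stabP; split=> [|v _]; last by rewrite perm1.
exact: (group1 (graph_aut_group G)).
Qed.

Lemma stabV (G : sgraph) (F : {set G}) (g : {perm G}) :
  g \in stab F -> g^-1%g \in stab F.
Proof.
move=> /stabP[gG gF]; apply/stabP; split=> [|v vF].
  by rewrite (groupV (graph_aut_group G)).
by rewrite -{1}(gF v vF) permK.
Qed.

Lemma stab_subset {G : sgraph} {A B : {set G}} :
  A \subset B -> stab B \subset stab A.
Proof.
move=> /subsetP sAB; apply/subsetP=> g /stabP[gG gB].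
by apply/stabP; split=> // v /sAB/gB.
Qed.

Lemma fixing_subset {G : sgraph} {A B : {set G}} :
  A \subset B -> fixing A -> fixing B.
Proof.
move=> sAB /eqP stA; rewrite /fixing eqEsubset sub1set stab1 andbT.
by rewrite -stA stab_subset.
Qed.

Lemma aut_fix_nonsimilar {G : sgraph} {g : {perm G}} {v : G} :
  g \in graph_aut G -> v \notin similar_vertices G -> g v = v.
Proof.
move=> gG; apply: contraNeq => gv; rewrite inE; apply/existsP; exists (g v).
by rewrite gv; apply/exists_inP; exists g.
Qed.

Lemma stab_setI_similar {G : sgraph} (F : {set G}) :
  stab (F :&: similar_vertices G) = stab F.
Proof.
apply/eqP; rewrite eqEsubset (stab_subset (subsetIl F _)) andbT.
apply/subsetP=> g /stabP[gG gF]; apply/stabP; split=> // v vF.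
have [vS|] := boolP (v \in similar_vertices G); last exact: aut_fix_nonsimilar.
by apply: gF; rewrite inE vF.
Qed.

Lemma eq_set2 (T : finType) (x y x' y' : T) :
  [set x; y] = [set x'; y'] ->
  (x = x' /\ y = y') \/ (x = y' /\ y = x').
Proof.
move=> E.
have: x \in [set x'; y'] by rewrite -E set21.
have: y \in [set x'; y'] by rewrite -E set22.
have: x' \in [set x; y] by rewrite E set21.
have: y' \in [set x; y] by rewrite E set22.
rewrite !in_set2.
by do 4![case/orP=> /eqP ?]; subst; auto.
Qed.

(** If [stab F] is trivial, no element of it can carry [x] to a different [y]. Conversely, if [g] in
    [stab F] moves [x], then [x] and [g x] form a similar pair that [F] fails to separate. *)
Lemma separated_pairsP (G : sgraph) (F : {set G}) :
  reflect (separated_pairs F = similar_pairs G) (fixing F).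
Proof.
apply: (iffP idP) => [/eqP stF|sepF].
  apply/setP=> p; apply/imset2P/imset2P=> -[x y xG]; rewrite !inE /=.
    move=> /and3P[xy sxy _] ->; exists x y => //.
    by rewrite !inE xy.
  move=> /andP[xy sxy] ->; exists x y => //; rewrite !inE xy sxy /=.
  apply/exists_inP=> -[g]; rewrite stF => /set1P->.
  by rewrite perm1 (negPf xy).
rewrite /fixing eqEsubset sub1set stab1 andbT; apply/subsetP=> g gF.
apply/set1P/permP=> x; rewrite perm1; apply/eqP; apply: contraT => gx.
have /stabP[gG _] := gF.
have: [set x; g x] \in similar_pairs G.
  apply/imset2P; exists x (g x) => //; rewrite !inE /= eq_sym gx /=.
  by apply/exists_inP; exists g.
rewrite -sepF => /imset2P[x' y' _]; rewrite !inE /= => /and3P[_ _ nsep] E.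
case/negP: nsep; apply/exists_inP.
(* The unordered pair may come back reversed; then the inverse of [g] carries [x'] to [y']. *)
have [[<- <-]|[<- <-]] := eq_set2 _ _ _ _ _ E; first by exists g.
by exists (g^-1)%g; rewrite ?stabV ?permK.
Qed.

Lemma exists_subset_card (T : finType) (A : {set T}) (k : nat) :
  k <= #|A| -> exists2 B : {set T}, B \subset A & #|B| = k.
Proof.
rewrite -bin_gt0 -cards_draws => /card_gt0P[B].
by rewrite inE => /andP[sBA /eqP cB]; exists B.
Qed.

Theorem theorem7 (G : sgraph) (n r t : nat)
  (G_connected : connected_graph G)
  (G_aut_nontrivial : graph_aut G <> 1%g)
  (order_G : #|G| = n)
  (card_S : #|similar_vertices G| = r)
  (t_range : 1 <= t <= r)
  (t_separating : all_separating G t)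
  (t_min : forall t' : nat, 1 <= t' <= r -> all_separating G t' -> t <= t') :
  fxd G = t + #|[set: G] :\: similar_vertices G|.
Proof.
rewrite setTD; set S := similar_vertices G; set m := #|~: S|.
have fixing_tm : all_fixing G (t + m).
  apply/forall_inP=> F /eqP cardF.
  (* At most [m] of the [t + m] vertices of [F] lie outside [S]. *)
  have le_t : t <= #|F :&: S|.
    rewrite -(leq_add2r m) -cardF -(cardsID S F) leq_add2l subset_leq_card //.
    by rewrite setDE subsetIr.
  have [B sB cB] := exists_subset_card _ _ _ le_t.
  have [sBF sBS] := subsetIP sB.
  exact/(fixing_subset sBF)/separated_pairsP/t_separating.
rewrite /fxd; case: ex_minnP => k fixing_k k_min.
apply/eqP; rewrite eqn_leq k_min //= leqNgt; apply/negP=> lt_k.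
(* If [k <= m], some [k]-set avoids [S]. Every automorphism fixes it pointwise, yet it is a fixing
   set, so the automorphism group would be trivial. Hence [m < k], which makes [k - m] positive, as
   [t_min] requires. *)
have [le_km|lt_mk] := leqP k m.
  have [B sB cB] := exists_subset_card _ _ _ le_km.
  apply: G_aut_nontrivial; apply/eqP; rewrite eqEsubset sub1set.
  rewrite (group1 (graph_aut_group G)) andbT.
  have /eqP <- : fixing B by apply: (forall_inP fixing_k); rewrite cB.
  apply/subsetP=> g gG; apply/stabP; split=> // v /(subsetP sB).
  by rewrite inE => /(aut_fix_nonsimilar gG).
have lt_t : k - m < t by rewrite ltn_subLR ?(ltnW lt_mk) // addnC.
suff: t <= k - m by rewrite leqNgt lt_t.
case/andP: t_range => _ le_tr; apply: t_min => [|F sFS cF].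
  by rewrite subn_gt0 lt_mk (leq_trans (ltnW lt_t)).
apply/separated_pairsP.
(* Adding all of [~: S] to [F] gives a set of exactly [k] vertices with the same stabilizer as
   [F]. *)
have trace : (F :|: ~: S) :&: S = F.
  by rewrite setIUl (setIC (~: S)) setICr setU0; apply/setIidPl.
have : fixing (F :|: ~: S).
  apply: (forall_inP fixing_k); rewrite cardsU.
  have -> : F :&: ~: S = set0 by apply/eqP; rewrite -setDE setD_eq0.
  by rewrite cards0 subn0 cF subnK // ltnW.
by rewrite /fixing -stab_setI_similar trace.
Qed.
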